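(* The sets $\mathcal{A}(n;r)$ are determined recursively as follows: $\mathcal{A}(1;1)$ consists of the trivial tree $\varnothing$ only, and for $n\ge 2$ and $1\le r\le n$, $$\begin{aligned}\mathcal{A}(n;r)=\;&\{A\prec_k e,\ A\prec_j\bar e \;:\; A\in\mathcal{A}(n-1;r-1),\ k=1,\ldots,r-2;\ j=1,\ldots,r-1\}\\ &\cup\{A\prec_k e,\ A\prec_j\bar e \;:\; A\in\mathcal{A}(n-1;r),\ k=r,\ldots,n-1;\ j=r+1,\ldots,n-1\},\end{aligned}$$ where $\mathcal{A}(n-1;0)$ and $\mathcal{A}(n-1;n)$ are the empty set.
   Context: Write $[n]=\{1,\ldots,n\}$. An arrow diagram on $n$ strings consists of $n$ vertical strings, oriented downward and placed from left to right in the order $1,\ldots,n$, together with finitely many arrows with distinct endpoints on the strings; diagrams are considered up to isomorphism preserving string labels and the order of arrow endpoints along each string. For $n\ge2$ and $t\in[n]$, $\mathcal{A}(n;t)$ is the set of planar tree diagrams with leaves on $[n]$ and trunk on $t$, i.e. arrow diagrams $A$ on $n$ strings such that: (d1) the tail and head of every arrow lie on different strings; (d2) there is exactly one arrow with tail on string $i$ for every $i\ne t$, and none with tail on string $t$; (d3) all arrowheads lie on strings indexed by $[n]$; (d4) on each string $i\ne t$ all arrowheads precede the unique arrowtail, following the downward orientation; and $A$ is planar: removing from each string $i\neq t$ the part below its arrowtail gives a rooted tree (leaves at the tops of the strings, root at the bottom of string $t$) that has a planar drawing with leaves in the left-to-right order $1,\ldots,n$. Explicitly: the arrows can be assigned distinct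 heights, compatible with the order of endpoints along each string (earlier means higher), so that for each arrow joining strings $a<b$ and each $c$ with $a<c<b$, string $c$ is not the trunk and its arrowtail is higher than the given arrow. By convention $\mathcal{A}(1;1)$ has the single element $\varnothing$, the trivial tree (one string, no arrows). Elementary trees: $e$ is the unique element of $\mathcal{A}(2;1)$ (one arrow, head on string $1$, tail on string $2$) and $\bar e$ is the unique element of $\mathcal{A}(2;2)$ (one arrow, head on string $2$, tail on string $1$). Stacking. For $P\in\mathcal{A}(n;r)$, $Q\in\mathcal{A}(m;s)$ and $k\in[n]$, the diagram $P\prec_k Q\in\mathcal{A}(m+n-1;t)$ is obtained by gluing the trunk of $Q$ on top of the $k$-th leaf of $P$: string $l$ of $Q$ becomes string $k+l-1$; string $l$ of $P$ becomes string $l$ if $l<k$, string $k+s-1$ if $l=k$, and string $l+m-1$ if $l>k$; on string $k+s-1$ the arrow endpoints coming from $Q$ precede those coming from $P$. The trunk is $t=r$ if $r<k$, $t=r+m-1$ if $r>k$, $t=r+s-1$ if $r=k$. In particular $P\prec_k\varnothing=P$ and $\varnothing\prec_1 P=P$. *)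

(* Defs.v *)
From HB Require Import structures.
From mathcomp Require Import all_boot.

Set Implicit Arguments.
Unset Strict Implicit.
Unset Printing Implicit Defensive.

(* An arrow has two endpoints: its tail (a, false) and its head (a, true). *)
Notation tail_of a := (a, false).
Notation head_of a := (a, true).

(* Strings are labelled 1, 2, ... from left to right. The endpoint x lies on
   string [str x] at depth [depth x], measured downwards: along a string, a
   smaller depth comes first. Only the order of the depths on each string is
   meaningful, see [diagram_iso]. The number of strings and the requirement
   that endpoints be distinct are imposed by [on_strings]. *)
Record arrow_diagram := ArrowDiagram {
  arrow : finType;
  str : arrow * bool -> nat;
  depth : arrow * bool -> nat
}.

Definition on_strings (n : nat) (D : arrow_diagram) : Prop :=
  (forall x : arrow D * bool, 1 <= str x <= n) /\
  (forall x y : arrow D * bool, str x = str y -> depth x = depth y -> x = y).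

Definition diagram_iso (D D' : arrow_diagram) : Prop :=
  exists f : arrow D -> arrow D',
    [/\ bijective f,
        forall (a : arrow D) (u : bool), str (f a, u) = str (a, u) &
        forall (a b : arrow D) (u v : bool), str (a, u) = str (b, v) ->
          (depth (f a, u) < depth (f b, v)) = (depth (a, u) < depth (b, v))].

(* That all arrowheads lie on strings in [n] is part of [on_strings]. *)
Definition tree_diagram (n t : nat) (D : arrow_diagram) : Prop :=
  [/\ forall a : arrow D, str (tail_of a) <> str (head_of a),
      forall i, 1 <= i <= n -> i <> t ->
        exists! a : arrow D, str (tail_of a) = i,
      forall a : arrow D, str (tail_of a) <> t &
      forall a b : arrow D, str (head_of a) = str (tail_of b) ->
        depth (head_of a) < depth (tail_of b)].

Definition planar (t : nat) (D : arrow_diagram) : Prop :=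
  exists height : arrow D -> nat,
    [/\ injective height,
        forall x y : arrow D * bool, str x = str y -> depth x < depth y ->
          height y.1 < height x.1 &
        forall (a : arrow D) (c : nat),
          minn (str (tail_of a)) (str (head_of a)) < c ->
          c < maxn (str (tail_of a)) (str (head_of a)) ->
          c <> t /\
          exists2 b : arrow D, str (tail_of b) = c & height a < height b].

(* The set A(n;t), as a predicate invariant under [diagram_iso]. It is empty
   unless t is in [n]; for n = t = 1 only arrowless diagrams satisfy it. *)
Definition planar_tree_diagram (n t : nat) (D : arrow_diagram) : Prop :=
  [/\ 1 <= t <= n, on_strings n D, tree_diagram n t D & planar t D].

Definition trivial_tree : arrow_diagram :=
  @ArrowDiagram void (fun=> 0) (fun=> 0).

(* e, the tree in A(2;1): head on string 1, tail on string 2 *)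
Definition tree_e : arrow_diagram :=
  @ArrowDiagram unit (fun x => if x.2 then 1 else 2) (fun=> 0).

(* \bar e, the tree in A(2;2): head on string 2, tail on string 1 *)
Definition tree_ebar : arrow_diagram :=
  @ArrowDiagram unit (fun x => if x.2 then 2 else 1) (fun=> 0).

(* [stack P k m s Q] is P \prec_k Q for Q in A(m;s). All endpoints of P are
   pushed below those of Q; this matters only on string k + s - 1, the only one
   that carries endpoints of both. *)
Definition stack (P : arrow_diagram) (k m s : nat) (Q : arrow_diagram) :
    arrow_diagram :=
  @ArrowDiagram (arrow P + arrow Q)%type
    (fun x => match x with
      | (inl a, u) =>
          let l := str (a, u) in
          if l < k then l else if l == k then k + s - 1 else l + m - 1
      | (inr b, u) => k + str (b, u) - 1
      end)
    (fun x => match x with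
      | (inl a, u) =>
          (\max_(y : arrow Q * bool) depth y).+1 + depth (a, u)
      | (inr b, u) => depth (b, u)
      end).

(* Main.v *)
Require Import Defs.
From HB Require Import structures.
From mathcomp Require Import all_boot.
From mathcomp Require Import zify.

Set Implicit Arguments.
Unset Strict Implicit.
Unset Printing Implicit Defensive.

(** Stacking an elementary tree on a leaf of a planar tree adds one string,
    next to the string of that leaf, and one arrow from the new string, placed
    above all other arrows. In formulas, [A \prec_k e] is [sprout A k.+1 k] and
    [A \prec_k \bar e] is [sprout A k k.+1] ([iso_stack_e], [iso_stack_ebar]).
    So the claim is that a diagram with at least two strings is a planar tree
    exactly if it is a planar tree with such an arrow added
    ([planar_tree_sprout]).

    Adding the arrow preserves planar trees because it can be drawn higher than
    everything else ([sprout_planar_tree]). Conversely, in a planar drawing of a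
    tree with at least two leaves the highest arrow has nothing above it, so it
    passes over no string, its string carries nothing but its tail, and its head
    is first on the string that it reaches ([top_arrow]). Removing it together
    with the string of its tail undoes the construction ([sprout_prune]) and
    leaves a planar tree ([sprout_planar_tree_inv]).

    It remains to compare positions. The string [p] of the new tail is not the
    trunk [r] of the larger tree. If [p < r], the trunk of the smaller tree is
    [r - 1]; if [p > r], it is [r]. As the stacking is at [p - 1] for [e] and at
    [p] for [\bar e], these two cases give the two sets of the recursion and the
    ranges of [k] and [j] in them. *)

(** * Isomorphism of diagrams *)

Lemma diagram_iso_sym D D' : diagram_iso D D' -> diagram_iso D' D.
Proof.
case=> f [[g fK gK] fstr fdepth]; exists g; split; first by exists f.
  by move=> a u; rewrite -fstr gK.
move=> a b u v; rewrite -{1}(gK a) -{1}(gK b) !fstr => eq_str.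
by rewrite -fdepth // !gK.
Qed.

Lemma diagram_iso_trans D2 D1 D3 :
  diagram_iso D1 D2 -> diagram_iso D2 D3 -> diagram_iso D1 D3.
Proof.
case=> f [f_bij fstr fdepth] [g [g_bij gstr gdepth]]; exists (g \o f).
split=> [|a u|a b u v eq_str] /=; first exact: bij_comp.
  by rewrite gstr fstr.
by rewrite gdepth ?fdepth ?fstr.
Qed.

Lemma diagram_iso_congr D D1 D2 :
  diagram_iso D1 D2 -> diagram_iso D D1 <-> diagram_iso D D2.
Proof.
move=> D12; split=> D_D; first exact: diagram_iso_trans D12.
exact: diagram_iso_trans (diagram_iso_sym D12).
Qed.

Lemma planar_tree_iso n t D D' :
  diagram_iso D D' -> planar_tree_diagram n t D' -> planar_tree_diagram n t D.
Proof.
case=> f [[g fK gK] fstr fdepth] [t_n [str_n inj_depth] [d1 d2 d2t d4] pl].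
have f_inj := can_inj fK.
split=> //.
- split=> [[a u]|[a u] [b v] eq_str eq_depth]; first by rewrite -fstr.
  (* Equal depths are incomparable, which [f] preserves. *)
  have: (f a, u) = (f b, v).
    apply: inj_depth; first by rewrite !fstr.
    have:= fdepth _ _ _ _ eq_str; have:= fdepth _ _ _ _ (esym eq_str).
    by rewrite eq_depth ltnn; lia.
  by case=> /f_inj-> ->.
- split=> [a|i i_n i_t|a|a b eq_str]; try by rewrite -!fstr.
    have [a [a_i a_uniq]] := d2 i i_n i_t.
    exists (g a); split; first by rewrite -fstr gK.
    by move=> b; rewrite -fstr => /a_uniq->; rewrite fK.
  by rewrite -fdepth // d4 // !fstr.
case: pl => h [h_inj h_depth h_pl]; exists (h \o f); split.
- exact: inj_comp.
- move=> [a u] [b v] eq_str lt_depth.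
  by apply: (h_depth (f a, u) (f b, v)); rewrite ?fstr ?fdepth.
move=> a c; rewrite -!fstr => lt_c c_lt.
have [c_t [b b_c h_b]] := h_pl (f a) c lt_c c_lt.
by split=> //; exists (g b); rewrite /= -?fstr gK.
Qed.

(** * Adding an arrow at the top *)

Definition adjacent (p q : nat) : Prop := q = p.+1 \/ p = q.+1.

(** The map [bump p] is the increasing injection of the naturals that skips
    [p]: the strings of [A] make room for a new string [p]. The new arrow [None]
    has depth [0] at both ends and all other depths are shifted up by one, so
    that its head precedes every other endpoint on string [q]. Having one
    construction with tail and head as parameters treats the two elementary
    trees together. *)
Definition sprout (A : arrow_diagram) (p q : nat) : arrow_diagram :=
  @ArrowDiagram (option (arrow A))
    (fun x => match x with
      | (Some a, u) => bump p (str (a, u))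
      | (None, u) => if u then q else p
      end)
    (fun x => match x with
      | (Some a, u) => (depth (a, u)).+1
      | (None, _) => 0
      end).

Lemma bij_sum_unit_option (T : Type) :
  bijective (fun x : T + unit => if x is inl a then Some a else None).
Proof.
by exists (fun o => if o is Some a then inl a else inr tt) => [[a|[]]|[a|]].
Qed.

Lemma iso_stack_e D A k :
  diagram_iso D (stack A k 2 1 tree_e) <-> diagram_iso D (sprout A k.+1 k).
Proof.
apply: diagram_iso_congr; exists (fun x => if x is inl a then Some a else None).
split; first exact: bij_sum_unit_option.
  by case=> [a|[]] u /=; rewrite /bump; [case: ltngtP; lia | case: u; lia].
by case=> [a|[]] [b|[]] u v /=; lia.
Qed.

Lemma iso_stack_ebar D A k :
  diagram_iso D (stack A k 2 2 tree_ebar) <-> diagram_iso D (sprout A k k.+1).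
Proof.
apply: diagram_iso_congr; exists (fun x => if x is inl a then Some a else None).
split; first exact: bij_sum_unit_option.
  by case=> [a|[]] u /=; rewrite /bump; [case: ltngtP; lia | case: u; lia].
by case=> [a|[]] [b|[]] u v /=; lia.
Qed.

Lemma bump_inj p : injective (bump p).
Proof. exact: can_inj (bumpK p). Qed.

Lemma ltn_bump2 p i j : (bump p i < bump p j) = (i < j).
Proof. by rewrite /bump; lia. Qed.

Lemma minn_bump p i j : minn (bump p i) (bump p j) = bump p (minn i j).
Proof. by rewrite /bump; lia. Qed.

Lemma maxn_bump p i j : maxn (bump p i) (bump p j) = bump p (maxn i j).
Proof. by rewrite /bump; lia. Qed.

Lemma bump_onto p i : i <> p -> exists j, i = bump p j.
Proof. by move=> /eqP i_p; exists (unbump p i); rewrite unbumpK. Qed.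

Lemma bump_range n p i :
  1 <= p <= n.+1 -> (1 <= bump p i <= n.+1) = (1 <= i <= n).
Proof. by rewrite /bump; lia. Qed.

Lemma bump_neq p i : bump p i <> p.
Proof. by apply/eqP; rewrite eq_sym neq_bump. Qed.

(** The new arrow can be drawn above all the others. It then crosses no string,
    as it joins adjacent ones; and it ends string [p] before any older arrow
    has to pass over that string. Older arrows are unaffected, because [bump p]
    preserves the left-to-right order. *)
Lemma sprout_planar_tree n t A p q :
    1 <= p <= n.+1 -> 1 <= q <= n.+1 -> adjacent p q ->
  planar_tree_diagram n t A ->
  planar_tree_diagram n.+1 (bump p t) (sprout A p q).
Proof.
move=> p_n q_n pq [t_n [str_n inj_depth] [d1 d2 d2t d4] pl].
have q_p : q <> p by case: pq; lia.
have bump_p := @bump_neq p; have bump_inj := @bump_inj p.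
split; first by rewrite bump_range.
- split=> [[[a|] []]|] /=; rewrite ?bump_range //.
  move=> [[a|] u] [[b|] v] //=; last first.
    by case: u v => [] [] // /esym/q_p.
  by move=> /bump_inj eq_str [/(inj_depth _ _ eq_str)[-> ->]].
- split=> [[a|] /=|i i_n i_t|[a|] /=|[a|] [b|] /=] //.
  + by move/bump_inj; apply: d1.
  + by move/esym.
  + case: (eqVneq i p) => [->|/eqP /bump_onto[j i_j]].
      by exists None; split=> // -[a|] //= /bump_p.
    subst i; rewrite bump_range // in i_n.
    have [|a [a_j a_uniq]] := d2 j i_n.
      by move=> j_t; apply: i_t; rewrite j_t.
    exists (Some a); split=> /= [|[b|] /=]; first by rewrite a_j.
      by move=> /bump_inj/a_uniq->.
    by move/esym/bump_p.
  + by move/bump_inj; apply: d2t.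
  + by move/esym/bump_p.
  + by move/bump_inj/d4.
  + by move/bump_p.
case: pl => h [h_inj h_depth h_pl].
pose hmax := \max_a h a.
have h_lt a : h a < hmax.+1 by rewrite ltnS /hmax leq_bigmax.
exists (oapp h hmax.+1); split.
- move=> [a|] [b|] //=; first by move/h_inj->.
    by move=> eq_h; have:= h_lt a; rewrite eq_h ltnn.
  by move=> eq_h; have:= h_lt b; rewrite eq_h ltnn.
- move=> [[a|] u] [[b|] v] //= /bump_inj eq_str.
  exact: (h_depth (a, u) (b, v)).
case=> [a|] c /=; last by case: pq; lia.
rewrite minn_bump maxn_bump.
case: (eqVneq c p) => [-> _ _|/eqP /bump_onto[d ->]].
  by split; [move/esym/bump_p | exists None => //=].
rewrite !ltn_bump2 => lt_d d_lt; have [d_t [b b_d h_b]] := h_pl a d lt_d d_lt.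
split; first by move/bump_inj.
by exists (Some b); rewrite //= b_d.
Qed.

(** Every condition on [A] is a condition on [sprout A p q] restricted to the
    older arrows. The only existence statements, those about the arrow with
    tail on a given string [bump p i], cannot be witnessed by the new arrow,
    whose tail is on string [p]. *)
Lemma sprout_planar_tree_inv n t A p q :
    1 <= p <= n.+1 ->
  planar_tree_diagram n.+1 (bump p t) (sprout A p q) ->
  planar_tree_diagram n t A.
Proof.
move=> p_n [t_n [str_n inj_depth] [d1 d2 d2t d4] pl].
have bump_p := @bump_neq p; have bump_inj := @bump_inj p.
split; first by rewrite bump_range in t_n.
- split=> [[a u]|[a u] [b v] eq_str eq_depth].
    by have:= str_n (Some a, u); rewrite /= bump_range.
  have: (Some a, u) = (Some b, v) :> arrow (sprout A p q) * bool.
    by apply: inj_depth; rewrite /= ?eq_str ?eq_depth.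
  by case=> -> ->.
- split=> [a eq_str|i i_n i_t|a eq_str|a b eq_str].
  + by case: (d1 (Some a)); rewrite /= eq_str.
  + have [||[a|] [/=]] := d2 (bump p i); rewrite ?bump_range //.
    * by move/bump_inj.
    * move=> /bump_inj a_i a_uniq; exists a; split=> // b b_i.
      by have:= a_uniq (Some b); rewrite /= b_i => /(_ erefl)[].
    * by move/esym/bump_p.
  + by case: (d2t (Some a)); rewrite /= eq_str.
  + by apply: (d4 (Some a) (Some b)); rewrite /= eq_str.
case: pl => h [h_inj h_depth h_pl]; exists (h \o Some); split.
- by apply: inj_comp => // a b [].
- move=> [a u] [b v] eq_str lt_depth.
  by apply: (h_depth (Some a, u) (Some b, v)); rewrite /= ?eq_str.
move=> a c lt_c c_lt; have:= h_pl (Some a) (bump p c).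
rewrite /= minn_bump maxn_bump !ltn_bump2 => /(_ lt_c c_lt) [c_t [[b|] /=]].
  move=> /bump_inj b_c h_b; split; last by exists b.
  by move=> eq_ct; apply: c_t; rewrite eq_ct.
by move/esym/bump_p.
Qed.

(** * Removing the top arrow *)

(** Dropping the string of the tail of [a] leaves a gap in the labels, which
    [unbump] closes; this undoes the relabelling by [bump] in [sprout]. *)
Definition prune (D : arrow_diagram) (a : arrow D) : arrow_diagram :=
  @ArrowDiagram {b : arrow D | b != a}
    (fun x => unbump (str (tail_of a)) (str (val x.1, x.2)))
    (fun x => depth (val x.1, x.2)).

(** The two hypotheses say that [a] could have been added last: its tail is
    alone on its string, and its head comes first on its string. *)
Lemma sprout_prune D (a : arrow D) :
    (forall x, str x = str (tail_of a) -> x = tail_of a) ->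
    (forall x, str x = str (head_of a) -> x <> head_of a ->
       depth (head_of a) < depth x) ->
  diagram_iso D (sprout (prune a) (str (tail_of a)) (str (head_of a))).
Proof.
move=> tail_only head_first.
(* [insub] maps [a] to [None] and every other arrow to itself. *)
exists insub; split.
- exists (oapp val a) => [b|[b|]] /=; last by rewrite insubF ?eqxx.
    by case: insubP => [c _ //|]; rewrite negbK => /eqP.
  by rewrite valK.
- move=> b u; case: insubP => [c c_a b_c /=|]; last first.
    by rewrite negbK => /eqP->; case: u.
  rewrite b_c unbumpK // inE; apply/eqP => /tail_only [b_a _].
  by rewrite b_a eqxx in c_a.
move=> b c u v.
case: insubP => [b' _ <- /=|]; last rewrite negbK => /eqP->.
  case: insubP => [c' _ <- //=|]; rewrite negbK => /eqP-> /=.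
  case: v => [eq_str|/tail_only[b_a]]; last by have:= valP b'; rewrite /= b_a eqxx.
  rewrite ltn0 ltnNge ltnW // head_first // => -[b_a].
  by have:= valP b'; rewrite /= b_a eqxx.
move=> eq_str; case: insubP => [c' _ c_c' /=|]; last rewrite negbK => /eqP c_a.
  rewrite -c_c' in eq_str *; case: u eq_str => [eq_str|/esym/tail_only[c_a]].
    by rewrite head_first // => -[c_a]; have:= valP c'; rewrite /= c_a eqxx.
  by have:= valP c'; rewrite /= c_a eqxx.
rewrite c_a /= in eq_str *.
case: u v eq_str => [] [] eq_str; rewrite ?ltnn //.
  by have [] := tail_only _ eq_str.
by have [] := tail_only _ (esym eq_str).
Qed.

(** This is where planarity enters. The arrow drawn highest can pass over no
    string, since such a string would have to be ended by a higher arrow. By the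
    compatibility of heights with depths, no endpoint precedes one of its two
    endpoints; on its tail string this excludes all arrowheads, which would
    have to precede the tail. *)
Lemma top_arrow n t D :
    1 < n -> planar_tree_diagram n t D ->
  exists a : arrow D,
    [/\ adjacent (str (tail_of a)) (str (head_of a)),
        forall x, str x = str (tail_of a) -> x = tail_of a &
        forall x, str x = str (head_of a) -> x <> head_of a ->
          depth (head_of a) < depth x].
Proof.
move=> n_gt1 [t_n [str_n inj_depth] [d1 d2 d2t d4] [h [h_inj h_depth h_pl]]].
have [a0 _] : exists a0 : arrow D, true.
  (* Any string other than the trunk carries a tail. *)
  have [||a0 _] := d2 (if t == 1 then 2 else 1); try by case: eqP; lia.
  by exists a0.
case: (arg_maxnP h (erefl true : xpredT a0)) => a _ a_max.
have not_higher b : ~ (h a < h b) by apply/negP; rewrite -leqNgt; apply: a_max.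
exists a; split.
- have neq := d1 a; rewrite /adjacent.
  case: (ltngtP (str (tail_of a)) (str (head_of a))) => // [lt|lt].
    case: (ltnP (str (tail_of a)).+1 (str (head_of a))) => [gap|]; last by lia.
    by have [||_ [b _ /not_higher]] := h_pl a (str (tail_of a)).+1; lia.
  case: (ltnP (str (head_of a)).+1 (str (tail_of a))) => [gap|]; last by lia.
  by have [||_ [b _ /not_higher]] := h_pl a (str (head_of a)).+1; lia.
- move=> [b []] eq_str.
    have lt := d4 b a eq_str.
    by have /not_higher := h_depth (head_of b) (tail_of a) eq_str lt.
  have [c [_ c_uniq]] := d2 _ (str_n (tail_of a)) (d2t a).
  by rewrite -(c_uniq a) // (c_uniq b).
move=> x eq_str neq; case: ltngtP => // [lt|/esym eq_depth].
  by have /not_higher := h_depth _ _ eq_str lt.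
by case: neq; apply: inj_depth.
Qed.

(** The recursion before stackings are sorted by the place of the new leaf
    relative to the trunk: the planar trees with at least two leaves are those
    obtained by adding a leaf next to the string that receives its arrow. *)
Lemma planar_tree_sprout n r D :
  planar_tree_diagram n.+2 r D <->
  exists A p q t, [/\ 1 <= p <= n.+2, 1 <= q <= n.+2, adjacent p q, r = bump p t
    & planar_tree_diagram n.+1 t A /\ diagram_iso D (sprout A p q)].
Proof.
split=> [D_tree|[A [p [q [t [p_n q_n pq -> [A_tree D_A]]]]]]]; last first.
  by apply: planar_tree_iso D_A _; apply: sprout_planar_tree.
have [//|a [pq tail_only head_first]] := top_arrow _ D_tree.
have D_A := sprout_prune tail_only head_first.
have [_ [str_n _] [_ _ /(_ a)/nesym/bump_onto[t r_t] _] _] := D_tree.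
exists (prune a), (str (tail_of a)), (str (head_of a)), t; split=> //; split=> //.
apply: (@sprout_planar_tree_inv _ _ _ _ (str (head_of a)) (str_n (tail_of a))).
by rewrite -r_t; apply: planar_tree_iso (diagram_iso_sym D_A) D_tree.
Qed.

Lemma planar_tree1 D : planar_tree_diagram 1 1 D <-> diagram_iso D trivial_tree.
Proof.
split=> [[_ [str_1 _] [_ _ d2t _] _]|D_triv].
  have no_arrow (a : arrow D) : False.
    by apply: (d2t a); have:= str_1 (tail_of a); lia.
  exists (fun a => match no_arrow a with end).
  split=> [|a|a]; try by case: (no_arrow a).
  by exists (fun v : void => match v with end) => [a|[]]; case: (no_arrow a).
apply: planar_tree_iso D_triv _; split=> //.
- by split=> [[[]]|[[]]].
- by split=> [[]|i i_1 /= i_neq1|[]|[]]; lia.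
by exists (fun=> 0); split=> [[]|[[]]|[]].
Qed.

(** * The recursion *)

Theorem proposition5p2 :
  (forall D : arrow_diagram,
     planar_tree_diagram 1 1 D <-> diagram_iso D trivial_tree) /\
  (forall n r : nat, 2 <= n -> 1 <= r <= n ->
   forall D : arrow_diagram,
     planar_tree_diagram n r D <->
     (exists A : arrow_diagram,
        planar_tree_diagram (n - 1) (r - 1) A /\
        ((exists k : nat, 1 <= k <= r - 2 /\
            diagram_iso D (stack A k 2 1 tree_e)) \/
         (exists j : nat, 1 <= j <= r - 1 /\
            diagram_iso D (stack A j 2 2 tree_ebar)))) \/
     (exists A : arrow_diagram,
        planar_tree_diagram (n - 1) r A /\
        ((exists k : nat, r <= k <= n - 1 /\
            diagram_iso D (stack A k 2 1 tree_e)) \/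
         (exists j : nat, r + 1 <= j <= n - 1 /\
            diagram_iso D (stack A j 2 2 tree_ebar))))).
Proof.
split; first exact: planar_tree1.
case=> [|[|n]] // r _ r_n D; rewrite !subn1 /= subn2 addn1.
split=> [/planar_tree_sprout[A [p [q [t [p_n q_n pq r_t [A_tree D_A]]]]]]|].
  have [[t_r p_r]|[t_r p_r]] : t = r.-1 /\ p <= r.-1 \/ t = r /\ r < p.
  - by rewrite r_t /bump; case: leqP; lia.
  - left; exists A; rewrite -t_r; split=> //.
    case: pq => eq_pq; rewrite eq_pq in D_A;
      [right; exists p | left; exists q]; (split; first lia).
      exact/iso_stack_ebar.
    exact/iso_stack_e.
  right; exists A; rewrite -t_r; split=> //.
  case: pq => eq_pq; rewrite eq_pq in D_A;
    [right; exists p | left; exists q]; (split; first lia).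
    exact/iso_stack_ebar.
  exact/iso_stack_e.
move=> stackings; apply/planar_tree_sprout.
by case: stackings => -[A [A_tree [[k [k_r D_A]]|[k [k_r D_A]]]]];
  [exists A, k.+1, k, r.-1 | exists A, k, k.+1, r.-1 |
   exists A, k.+1, k, r | exists A, k, k.+1, r];
  (split; [lia | lia | rewrite /adjacent; lia | rewrite /bump; case: leqP; lia |
   split=> //; (exact/iso_stack_e || exact/iso_stack_ebar)]).
Qed.
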